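(* Let $S\in\mathbb{R}^{s\times s}$ be the Schur complement of an abs-normal form with nonsingular $J$, and let $\rho(|S|)$ be the spectral radius of its componentwise modulus. Suppose that $\rho(|S|)<1/2$, or that $\rho(|S|)=1/2$ and $S$ is irreducible. Let $H(z)=z-S|z|$. Then for every $\hat c\in\mathbb{R}^s$, any iteration of the form $$z^+=(I-S\hat\Sigma)^{-1}\hat c,\qquad \hat\Sigma=\mathrm{diag}(\hat\sigma),\ \hat\sigma\in[-1,1]^s,\ |z|=\hat\Sigma z,$$ converges in at most $s$ iterations from any $z_0\in\mathbb{R}^s$ to the unique solution $z_*=H^{-1}(\hat c)$.
   Context: Abs-normal form: $z=c+Zx+L|z|$, $F(x)=b+Jx+Y|z|$, with $c\in\mathbb{R}^s$, $b\in\mathbb{R}^n$, $Z\in\mathbb{R}^{s\times n}$, $L\in\mathbb{R}^{s\times s}$ strictly lower triangular, $J\in\mathbb{R}^{n\times n}$, $Y\in\mathbb{R}^{n\times s}$; its Schur complement is $S=L-ZJ^{-1}Y$. $|\cdot|$ acts componentwise on vectors and matrices. In each iteration $\hat\sigma$ is an arbitrary vector in $[-1,1]^s$ compatible with the current iterate $z$, i.e. $\hat\sigma_iz_i=|z_i|$ for all $i$ (so $\hat\sigma_i=\mathrm{sign}(z_i)$ if $z_i\neq0$, and $\hat\sigma_i\in[-1,1]$ is arbitrary if $z_i=0$). Irreducible means not permutation-similar to a block triangular matrix (with at least two diagonal blocks).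
   Formalization: ''Converges in at most s iterations'' is taken as: some iterate z_k with k ≤ s has the signs of z_*, and all later iterates equal z_* (so s+1 steps); literally z_s = z_* fails for s=1, S=1/4, ĉ=1, z_0=-1, where z_1=4/5 but z_*=4/3. *)

(* Defs.v *)
From HB Require Import structures.
From mathcomp Require Import all_boot all_order all_algebra all_fingroup.
From mathcomp Require Import complex.
From mathcomp Require Import classical_sets reals.
Set Implicit Arguments.
Unset Strict Implicit.
Unset Printing Implicit Defensive.
Import Order.TTheory GRing.Theory Num.Theory.
Local Open Scope ring_scope.
Local Open Scope complex_scope.

(** Abs-normal form in [n] variables with [s] switching variables:
    [z = c + Z x + L |z|],  [F x = b + J x + Y |z|]. *)
Record abs_normal_form (R : realType) (n s : nat) := AbsNormalForm {
  anf_c : 'cV[R]_s;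
  anf_b : 'cV[R]_n;
  anf_Z : 'M[R]_(s, n);
  anf_L : 'M[R]_s;
  anf_J : 'M[R]_n;
  anf_Y : 'M[R]_(n, s);
  anf_L_strictly_lower : forall i j : 'I_s, (i <= j)%N -> anf_L i j = 0
}.

Definition schur_complement (R : realType) (n s : nat)
    (A : abs_normal_form R n s) : 'M[R]_s :=
  anf_L A - anf_Z A *m invmx (anf_J A) *m anf_Y A.

(** Componentwise modulus; not the matrix norm that MathComp-Analysis
    attaches to [`|A|]. *)
Definition absmx (R : realType) (m n : nat) (A : 'M[R]_(m, n)) : 'M[R]_(m, n) :=
  map_mx (fun x : R => `|x|) A.

(** The eigenvalues are the complex ones; a [0 x 0] matrix has spectral
    radius [sup set0 = 0]. *)
Definition spectral_radius (R : realType) (n : nat) (A : 'M[R]_n) : R :=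
  sup [set r : R | exists2 l : R[i],
         eigenvalue (map_mx (fun x : R => x%:C) A) l & `|l| = r%:C]%classic.

(** Block upper triangular with square diagonal blocks of orders [k] and
    [n - k].  With two nonempty blocks this is the general case: consecutive
    blocks can be merged, and reversing the order of the indices exchanges
    upper and lower. *)
Definition block_triangular (R : realType) (n k : nat) (A : 'M[R]_n) : Prop :=
  forall i j : 'I_n, (j < k <= i)%N -> A i j = 0.

Definition irreducible_mx (R : realType) (n : nat) (A : 'M[R]_n) : Prop :=
  ~ exists (p : 'S_n) (k : nat),
      (0 < k < n)%N /\
      block_triangular k (perm_mx p *m A *m (perm_mx p)^T).

Definition sigma_box (R : realType) (s : nat) (sigma : 'cV[R]_s) : Prop :=
  forall i, -1 <= sigma i 0 <= 1.

Definition Sigma_mx (R : realType) (s : nat) (sigma : 'cV[R]_s) : 'M[R]_s :=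
  diag_mx sigma^T.

Definition Hmap (R : realType) (s : nat) (S : 'M[R]_s) (z : 'cV[R]_s) :
    'cV[R]_s :=
  z - S *m absmx z.

(** [sigma k] is the (freely chosen) signature used to pass from [z k] to
    [z k.+1]. *)
Definition signature_iteration (R : realType) (s : nat) (S : 'M[R]_s)
    (chat : 'cV[R]_s) (z sigma : nat -> 'cV[R]_s) : Prop :=
  forall k : nat,
    [/\ sigma_box (sigma k),
        absmx (z k) = Sigma_mx (sigma k) *m z k
      & z k.+1 = invmx (1%:M - S *m Sigma_mx (sigma k)) *m chat].

(** Finite convergence to [zstar] in at most [N] iterations, counted up to the
    iterate [z k] that has identified the sign pattern of [zstar]: the linear
    system solved from [z k] is then the one of the linear piece containing
    [zstar], and all later iterates equal [zstar].  Counting up to the first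
    iterate equal to [zstar] would need [N + 1]: for [s = 1], [S = 1/4],
    [chat = 1] and [z 0 = -1], one gets [z 1 = 4/5] but [zstar = 4/3]. *)
Definition converges_within (R : realType) (s : nat) (N : nat)
    (z : nat -> 'cV[R]_s) (zstar : 'cV[R]_s) : Prop :=
  exists k : nat,
    [/\ (k <= N)%N,
        forall i, Num.sg (z k i 0) = Num.sg (zstar i 0)
      & forall m : nat, (k < m)%N -> z m = zstar].

(* Main.v *)
Require Import Defs.
From mathcomp Require Import all_boot all_order all_algebra all_fingroup.
From mathcomp Require Import reals.
From mathcomp Require Import complex polyrcf ring lra.
From mathcomp Require classical_sets.
Set Implicit Arguments.
Unset Strict Implicit.
Unset Printing Implicit Defensive.
Import Order.TTheory GRing.Theory Num.Theory.
Local Open Scope ring_scope.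

(** Rescaling.  Put [A = |S|].  The hypothesis on the spectral radius yields a
    positive vector [v] with [A v <= v / 2], strictly in every row when the
    radius is below [1/2].  Passing from [z] to [z_i / v_i] turns the iteration
    into the same iteration for the matrix [S_ij v_j / v_i], whose absolute row
    sums are at most [1/2]; so row sums may replace the spectral radius.

    One sign per step.  Every iterate after the starting point solves
    [z = c + S Sigma z]; it vanishes if [c = 0].  Otherwise, absolute row sums at
    most [1/2] force [|z| <= 2 |c|] in the maximum norm, hence
    [|z_i - c_i| <= |c_i|] at an index [i] where [|c_i|] is maximal.  Except in
    an extremal configuration this makes [z_i] and [c_i] share their sign,
    whatever [Sigma] was ([sgr_of_max]).  From the first iterate on, [sigma_i]
    is therefore the constant [sg c_i], the [i]-th equation can be solved for
    [z_i], and the other components follow an iteration of the same form with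
    one variable fewer.  The Schur complement again has row sums at most [1/2]
    ([half_dominant_eliminated]), so induction shows that after [s] steps all
    signs are determined by [S] and [c] alone ([sign_iteration_stabilizes]).

    The borderline case.  Irreducibility need not pass to Schur complements.  The
    condition [half_dominant] does, and it excludes the extremal
    configuration: a nonempty set of indices closed under the nonzero entries of
    [S] is everything, or has a row whose sum is strictly below [1/2].

    Conclusion.  Two iterations for the same [c] have equal signs from step [s]
    on.  The iteration that uses [Sigma = diag (sg z)] thus keeps the same
    [Sigma] from step [s] to step [s + 1], so that step [s + 1] solves
    [z - S |z| = c].  Any other iteration solves, from step [s] on, the linear
    system of the piece containing this solution. *)

(** * Iterations with row sums at most one half *)

Section Elimination.
Variables (R : realFieldType) (I : finType).
Implicit Types (Q T : {set I}) (S : I -> I -> R) (c z x : I -> R).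

Definition abs_row_sum Q S i : R := \sum_(j in Q) `|S i j|.

(** The condition on closed sets [T] unifies the two hypotheses on [S]: when all
    row sums are below [1/2] the second alternative always holds, and when [S]
    is irreducible the first one does.  Unlike irreducibility it survives the
    elimination of a variable. *)
Definition half_dominant Q S : Prop :=
  (forall i, i \in Q -> abs_row_sum Q S i <= 2^-1) /\
  (forall T, T != set0 -> T \subset Q ->
     (forall i j, i \in T -> j \in Q :\: T -> S i j = 0) ->
     T = Q \/ exists2 i, i \in T & abs_row_sum Q S i < 2^-1).

(** The components in [Q] of [z = c + S Sigma z], the variables outside [Q] having
    been eliminated. *)
Definition solves Q S c (sigma z : I -> R) : Prop :=
  forall i, i \in Q -> z i = c i + \sum_(j in Q) S i j * (sigma j * z j).

Definition in_box Q (sigma : I -> R) : Prop :=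
  forall i, i \in Q -> `|sigma i| <= 1.

Lemma solves_deviation Q S c sigma z i : in_box Q sigma ->
  solves Q S c sigma z -> i \in Q ->
  `|z i - c i| <= \sum_(j in Q) `|S i j| * `|z j|.
Proof.
move=> box sol Qi; rewrite (sol i Qi) addrC addKr.
apply: le_trans (ler_norm_sum _ _ _) _; apply: ler_sum => j Qj.
by rewrite !normrM ler_wpM2l // ler_piMl // box.
Qed.

Lemma ex_max_norm Q x i0 : i0 \in Q ->
  exists2 i, i \in Q & forall j, j \in Q -> `|x j| <= `|x i|.
Proof.
move=> Qi0; case: (arg_maxP (fun i => `|x i|) Qi0) => i Qi max_i.
by exists i.
Qed.

(** At the largest [|z_m|] the equation gives [|z_m| <= M + |z_m| / 2]. *)
Lemma solves_norm_bound Q S c sigma z M i : half_dominant Q S ->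
  in_box Q sigma -> solves Q S c sigma z -> (forall j, j \in Q -> `|c j| <= M) ->
  i \in Q -> `|z i| <= 2 * M.
Proof.
move=> [rows _] box sol cM Qi.
have [m Qm max_m] := ex_max_norm z Qi.
apply: le_trans (max_m i Qi) _.
have dev := solves_deviation box sol Qm.
have : \sum_(j in Q) `|S m j| * `|z j| <= 2^-1 * `|z m|.
  apply: (@le_trans _ _ (abs_row_sum Q S m * `|z m|));
    last by rewrite ler_wpM2r ?rows.
  by rewrite mulr_suml ler_sum // => j Qj; rewrite ler_wpM2l ?max_m.
have := ler_normD (z m - c m) (c m); rewrite subrK.
have := cM m Qm; lra.
Qed.

Lemma solves0 Q S c sigma z i : half_dominant Q S -> in_box Q sigma ->
  solves Q S c sigma z -> (forall j, j \in Q -> c j = 0) -> i \in Q -> z i = 0.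
Proof.
move=> dom box sol c0 Qi; apply/normr0_eq0/le_anti; rewrite normr_ge0 andbT.
rewrite -[leRHS](mulr0 2); apply: solves_norm_bound dom box sol _ Qi => j Qj.
by rewrite c0 ?normr0.
Qed.

Lemma norm_sub_sg_neq (x y : R) :
  Num.sg x != Num.sg y -> `|x - y| = `|x| + `|y|.
Proof.
have [x0|x0|->] := ltrgt0P x; have [y0|y0|->] := ltrgt0P y => //.
- by rewrite !gtr0_sg ?eqxx.
- by move=> _; rewrite gtr0_norm //; lra.
- by rewrite subr0 addr0 gtr0_norm.
- by move=> _; rewrite ltr0_norm; lra.
- by rewrite !ltr0_sg ?eqxx.
- by rewrite subr0 addr0 ltr0_norm.
- by rewrite sub0r normrN ?normr0 gtr0_norm // => _; lra.
- by rewrite sub0r normrN ?normr0 ltr0_norm // => _; lra.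
- by rewrite eqxx.
Qed.

(** If the signs differed, [|z_i - c_i| = |z_i| + |c_i|] would meet the bound
    [|c_i|], so that [z_i = 0] and every inequality on row [i] is an equality:
    the successors [j] of [i] satisfy [|z_j| = 2 |c_i|], and then so do their own
    successors.  The set of such [j] is nonempty and closed, contains no strict
    row, and misses [i]; [half_dominant] forbids this. *)
Lemma sgr_of_max Q S c sigma z i : half_dominant Q S -> in_box Q sigma ->
  solves Q S c sigma z -> i \in Q -> (forall j, j \in Q -> `|c j| <= `|c i|) ->
  c i != 0 -> Num.sg (z i) = Num.sg (c i).
Proof.
move=> dom box sol Qi max_i ci0; apply/eqP; apply: contraT => neq_sg.
have zM j : j \in Q -> `|z j| <= 2 * `|c i|.
  exact: solves_norm_bound dom box sol max_i.
have [rows closed] := dom; have M_gt0 : 0 < `|c i| by rewrite normr_gt0.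
have sumM j : j \in Q ->
    \sum_(k in Q) `|S j k| * `|z k| <= abs_row_sum Q S j * (2 * `|c i|).
  by move=> Qj; rewrite mulr_suml ler_sum // => k Qk; rewrite ler_wpM2l ?zM.
have dev j := solves_deviation box sol (i := j).
have zi0 : `|z i| = 0.
  apply/le_anti; rewrite normr_ge0 andbT.
  have := dev i Qi; rewrite norm_sub_sg_neq // => dev_i.
  have := sumM i Qi.
  have : abs_row_sum Q S i * (2 * `|c i|) <= 2^-1 * (2 * `|c i|).
    by rewrite ler_wpM2r ?rows //; lra.
  lra.
have sum_i : `|c i| <= \sum_(k in Q) `|S i k| * `|z k|.
  by have := dev i Qi; rewrite norm_sub_sg_neq // zi0 add0r.
(* The sum is at most 1/2 * 2 |c i| in any row, so that attaining |c i| leaves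
   no slack in any term. *)
have extremal j k : j \in Q -> k \in Q ->
    `|c i| <= \sum_(k in Q) `|S j k| * `|z k| -> S j k != 0 -> `|z k| = 2 * `|c i|.
  move=> Qj Qk sum_j Sjk; apply/le_anti; rewrite zM //=.
  rewrite -(ler_pM2l (x := `|S j k|)) ?normr_gt0 //.
  have : \sum_(l in Q | l != k) `|S j l| * `|z l| <=
         \sum_(l in Q | l != k) `|S j l| * (2 * `|c i|).
    by apply: ler_sum => l /andP[Ql _]; rewrite ler_wpM2l ?zM.
  move: sum_j; rewrite (bigD1 k) //=.
  have := ler_wpM2r (ltW M_gt0) (rows j Qj).
  rewrite /abs_row_sum (bigD1 k) //= -mulr_suml; lra.
pose T := [set j in Q | `|z j| == 2 * `|c i|].
have sum_T j : j \in T -> `|c i| <= \sum_(k in Q) `|S j k| * `|z k|.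
  rewrite inE => /andP[Qj /eqP zj].
  have := dev j Qj; have := ler_normD (z j - c j) (c j); rewrite subrK zj.
  have := max_i j Qj; lra.
have T0 : T != set0.
  apply/set0Pn; have [k] : exists2 k, k \in Q & S i k != 0.
    apply/exists_inP; apply: contraT => /exists_inPn Si0.
    move: sum_i; rewrite big1 ?leNgt ?M_gt0 // => k Qk.
    by move/negPn/eqP: (Si0 k Qk) => ->; rewrite normr0 mul0r.
  by move=> Qk Sik; exists k; rewrite inE Qk (extremal i) /=.
have subTQ : T \subset Q by apply/subsetP => j; rewrite inE => /andP[].
have [|TQ|[j Tj]] := closed T T0 subTQ.
- move=> j k Tj; rewrite !inE => /andP[nTk Qk]; apply/eqP.
  apply: contraR nTk => Sjk; rewrite Qk (extremal j) ?eqxx //.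
    exact: (subsetP subTQ).
  exact: sum_T.
- by move: Qi; rewrite -TQ inE zi0 => /andP[_ /eqP]; lra.
- rewrite -(ltr_pM2r (x := 2 * `|c i|)); last by lra.
  have := sum_T j Tj; have := sumM j (subsetP subTQ j Tj); lra.
Qed.

(** With [S'] for this matrix and [t] the known value of [sigma_i], [1 - S' Sigma]
    is the Schur complement of the pivot [1 - S_ii t] in [1 - S Sigma]. *)
Definition eliminated S i (t : R) k j : R :=
  S k j + S k i * t * S i j / (1 - S i i * t).

Lemma sol_elim Q S c sigma z i : i \in Q -> 1 - S i i * sigma i != 0 ->
  solves Q S c sigma z ->
  solves (Q :\ i) (eliminated S i (sigma i))
    (fun k => c k + S k i * sigma i * c i / (1 - S i i * sigma i)) sigma z.
Proof.
move=> Qi piv sol k /setD1P[ki Qk].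
have := sol i Qi; have := sol k Qk.
rewrite !(big_setD1 i Qi) /=.
set A := (X in z k = c k + (_ + X)).
set B := (X in z i = c i + (_ + X)) => ek ei.
have -> : \sum_(j in Q :\ i) eliminated S i (sigma i) k j * (sigma j * z j) =
          A + S k i * sigma i / (1 - S i i * sigma i) * B.
  rewrite mulr_sumr -big_split /=; apply: eq_bigr => j _.
  by rewrite /eliminated; field.
have {}ei : z i = (c i + B) / (1 - S i i * sigma i).
  by apply: (mulIf piv); rewrite divfK //; move: ei; lra.
by rewrite {1}ek ei; field.
Qed.

Lemma diag_le_half Q S i t : half_dominant Q S -> i \in Q -> `|t| <= 1 ->
  `|S i i * t| <= 2^-1.
Proof.
move=> [rows _] Qi t1; rewrite normrM; apply: le_trans (ler_piMr _ t1) _ => //.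
apply: le_trans (rows i Qi); rewrite /abs_row_sum (big_setD1 i Qi) /=.
by rewrite lerDl sumr_ge0.
Qed.

Lemma pivot_ge_half Q S i t : half_dominant Q S -> i \in Q -> `|t| <= 1 ->
  2^-1 <= 1 - S i i * t.
Proof.
by move=> dom Qi t1; have /ler_normlP[] := diag_le_half dom Qi t1; lra.
Qed.

(** With [a = |S_ii|], the entries of row [i] outside the diagonal sum to at most
    [1/2 - a], and after division by the pivot to at most
    [(1/2 - a) / (1 - a) <= 1/2]: substituting row [i] replaces the weight
    [|S_ki|] by at most half of it.  The loss of [|S_ki| / 2] makes every row that
    refers to [i] strict. *)
Lemma abs_row_sum_eliminated Q S i t k : half_dominant Q S -> i \in Q ->
  `|t| <= 1 ->
  abs_row_sum (Q :\ i) (eliminated S i t) k <= abs_row_sum Q S k - `|S k i| / 2.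
Proof.
move=> dom Qi t1; have piv := pivot_ge_half dom Qi t1.
have [rows _] := dom; have := rows i Qi.
rewrite /abs_row_sum !(big_setD1 i Qi) /=.
set B := \sum_(j in Q :\ i) `|S i j|.
set A := \sum_(j in Q :\ i) `|S k j| => rowi.
have -> : `|S k i| + A - `|S k i| / 2 = A + `|S k i| * 2^-1 by field.
apply: (@le_trans _ _ (A + `|S k i| * (B / (1 - S i i * t)))).
  rewrite mulr_suml mulr_sumr -big_split /=; apply: ler_sum => j _.
  apply: le_trans (ler_normD _ _) _; rewrite lerD2l !normrM.
  rewrite normfV (gtr0_norm (x := 1 - _)); last by lra.
  rewrite -!mulrA ler_wpM2l // ler_piMl // mulr_ge0 // invr_ge0; lra.
rewrite lerD2l ler_wpM2l // ler_pdivrMr; last by lra.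
have : S i i * t <= `|S i i|.
  by rewrite (le_trans (ler_norm _)) // normrM ler_piMr.
have := normr_ge0 (S i i); lra.
Qed.

(** A closed set for the reduced matrix either refers to [i], and then has a row
    that became strict, or has unchanged rows; in that case it was closed before
    the elimination, and had a strict row since it differs from [Q]. *)
Lemma half_dominant_eliminated Q S i t : half_dominant Q S -> i \in Q ->
  `|t| <= 1 -> half_dominant (Q :\ i) (eliminated S i t).
Proof.
move=> dom Qi t1; have row_le k := abs_row_sum_eliminated k dom Qi t1.
have [rows closed] := dom; split.
  move=> k /setD1P[_ Qk]; have := row_le k; have := rows k Qk.
  have := normr_ge0 (S k i); lra.
move=> T T0 subT closedT; right.
have memT k : k \in T -> k \in Q by move/(subsetP subT)/setD1P => [].
have [/exists_inP[k Tk Ski]|/exists_inPn Si0] :=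
  boolP [exists k in T, S k i != 0].
  exists k => //; have := row_le k; have := rows k (memT k Tk).
  have : 0 < `|S k i| by rewrite normr_gt0.
  lra.
have {}Si0 k : k \in T -> S k i = 0 by move/Si0/negPn/eqP.
have same k j : k \in T -> eliminated S i t k j = S k j.
  by move=> Tk; rewrite /eliminated Si0 // !mul0r addr0.
have [||TQ|[k Tk strict]] := closed T T0.
- by apply/subsetP => k /memT.
- move=> k j Tk /setDP[Qj nTj]; have [->|ji] := eqVneq j i; first exact: Si0.
  by rewrite -same // closedT // inE nTj !inE ji.
- by move/subsetP: subT => /(_ i); rewrite TQ Qi => /(_ isT); rewrite !inE eqxx.
- exists k => //; have := row_le k; rewrite Si0 // normr0 mul0r subr0.
  by move/le_lt_trans; apply.
Qed.

Definition sign_iteration Q S c (z sigma : nat -> I -> R) : Prop :=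
  forall k, [/\ in_box Q (sigma k),
    forall i, i \in Q -> sigma k i * z k i = `|z k i|
    & solves Q S c (sigma k) (z k.+1)].

Lemma sigma_sgr (a x : R) : x != 0 -> a * x = `|x| -> a = Num.sg x.
Proof. by move=> x0 e; apply: (mulIf x0); rewrite e normrEsg. Qed.

(** [tau] is chosen before the iteration: the limiting signs depend neither on the
    starting point nor on the choices of [sigma]. *)
Theorem sign_iteration_stabilizes Q S c : half_dominant Q S ->
  exists tau : I -> R, forall z sigma : nat -> I -> R,
  sign_iteration Q S c z sigma ->
  forall k i, (#|Q| <= k)%N -> i \in Q -> Num.sg (z k i) = tau i.
Proof.
move Dn : #|Q| => n; elim: n Q S c Dn => [|n IH] Q S c Dn dom.
  by exists (fun=> 0) => z sigma _ k i _; rewrite (cards0_eq Dn) inE.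
have [i0 Qi0] : exists i, i \in Q by apply/card_gt0P; rewrite Dn.
have [i Qi max_i] := ex_max_norm c Qi0.
have [ci0|ci0] := eqVneq (c i) 0.
  exists (fun=> 0) => z sigma iter [//|k] j _ Qj.
  have [box _ sol] := iter k;
  rewrite (solves0 dom box sol _ Qj) ?sgr0 // => l Ql.
  by apply/eqP; rewrite -normr_le0 -[leRHS](normr0 R) -ci0 max_i.
set t := Num.sg (c i).
have t1 : `|t| <= 1 by rewrite normr_sg; case: (_ != _).
have Dn' : #|Q :\ i| = n by move: Dn; rewrite (cardsD1 i) Qi => -[].
have [tau tauP] := IH _ _ (fun k => c k + S k i * t * c i / (1 - S i i * t))
  Dn' (half_dominant_eliminated dom Qi t1).
exists (fun j => if j == i then t else tau j) => z sigma iter k j.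
have sg_i l : Num.sg (z l.+1 i) = t.
  by have [box _ sol] := iter l; apply: sgr_of_max dom box sol Qi max_i ci0.
have zi0 l : z l.+1 i != 0 by rewrite -sgr_eq0 sg_i sgr_eq0.
(* The sign of [z 0 i] is arbitrary, so the reduced iteration starts at [z 1]. *)
case: k => [//|k]; rewrite ltnS => nk Qj; have [->//|ji] := eqVneq j i.
apply: (tauP (fun l => z l.+1) (fun l => sigma l.+1)) => //;
  last by rewrite !inE ji.
move=> l; have [box compat sol] := iter l.+1.
have sigma_i : sigma l.+1 i = t.
  by rewrite (sigma_sgr (zi0 l) (compat i Qi)) sg_i.
split=> [a /setD1P[_ Qa]|a /setD1P[_ Qa]|]; [exact: box|exact: compat|].
rewrite -sigma_i; apply: sol_elim => //.
by have := pivot_ge_half dom Qi (box i Qi); lra.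
Qed.

End Elimination.

(** * Positive vectors from the spectral radius *)

Section Perron.
Variable R : rcfType.

Lemma horner_ge0_right (p : {poly R}) (r : R) :
  (forall t, r < t -> 0 <= p.[t]) -> 0 <= p.[r].
Proof.
move=> p_ge0; rewrite leNgt; apply/negP => pr_lt0.
have [|d d_gt0 near_r] := @poly_cont _ r p (- p.[r]); first by lra.
have := near_r (r + d / 2).
rewrite addrAC subrr add0r gtr0_norm; last by lra.
move/(_ ltac:(lra)); rewrite ltr_norml => /andP[_].
have := p_ge0 (r + d / 2); move/(_ ltac:(lra)); lra.
Qed.

Lemma ex_largest_root (p : {poly R}) (r t : R) : p != 0 -> root p r -> t <= r ->
  exists m, [/\ root p m, t <= m & forall x, root p x -> x <= m].
Proof.
move=> p0 pr tr.
have mem_roots x : root p x = (x \in rootsR p).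
  by rewrite -(roots_on_rootsR p0).
have [m] : exists2 m, m \in rootsR p & {in rootsR p, forall x, x <= m}.
  have: rootsR p != [::] by apply: contraTneq pr => e; rewrite mem_roots e.
  elim: (rootsR p) => [//|x [|y l] IH _].
    by exists x; rewrite ?mem_head // => u; rewrite inE => /eqP->.
  have [//|m lm max_m] := IH.
  exists (Num.max x m).
    by rewrite inE; case: leP; rewrite ?eqxx // lm orbT.
  move=> u; rewrite inE le_max => /predU1P[->|/max_m->]; rewrite ?lexx ?orbT //.
rewrite -mem_roots => pm max_m.
exists m; split=> //; last by move=> x; rewrite mem_roots; apply: max_m.
by apply: le_trans tr _; apply: max_m; rewrite -mem_roots.
Qed.

Variables (n : nat) (A : 'M[R]_n).

(** At a point [t] outside the spectrum this is the solution of
    [(t - A) y = 1], multiplied by the characteristic polynomial so as to remain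
    defined at the eigenvalues. *)
Definition adjsum : 'cV[{poly R}]_n := \adj (char_poly_mx A) *m const_mx 1.

Lemma adjsumE (t : R) i :
  t * (adjsum i 0).[t] - \sum_j A i j * (adjsum j 0).[t] = (char_poly A).[t].
Proof.
have : (char_poly_mx A *m adjsum) i 0 = char_poly A.
  by rewrite mulmxA mul_mx_adj mul_scalar_mx !mxE mulr1.
rewrite mulmxBl mul_scalar_mx; move: adjsum => y /(congr1 (horner^~ t)) <-.
rewrite !mxE hornerD hornerN hornerM hornerX; congr (_ - _).
by rewrite horner_sum; apply: eq_bigr => j _; rewrite mxE hornerM hornerC.
Qed.

Hypothesis A_ge0 : forall i j, 0 <= A i j.

(** For [u] above all row sums, [u - A] is diagonally dominant, and the smallest
    component of the solution is positive. *)
Lemma adjsum_gt0_large (u : R) : 0 < (char_poly A).[u] ->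
  (forall i, \sum_j A i j < u) -> forall i, 0 < (adjsum i 0).[u].
Proof.
move=> det_gt0 uA i.
case: (arg_minP (fun i => (adjsum i 0).[u]) (erefl : predT i)) => m _ min_m.
apply: lt_le_trans (min_m i isT).
rewrite -(pmulr_rgt0 _ (x := u - \sum_j A m j)); last by rewrite subr_gt0.
apply: lt_le_trans det_gt0 _; rewrite -(adjsumE u m) mulrBl lerD2l lerN2.
by rewrite mulr_suml ler_sum // => j _; rewrite ler_wpM2l ?min_m.
Qed.

Lemma noroot_gt0 (p : {poly R}) (t u : R) :
  (forall x, t <= x -> ~~ root p x) -> t <= u -> 0 < p.[u] ->
  forall x, t <= x -> 0 < p.[x].
Proof.
move=> nr tu pu x tx; rewrite -sgr_cp0.
have sg y : t <= y -> Num.sg p.[y] = sgp_pinfty p.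
  move=> ty; apply: (sgp_pinftyP (x := t)); last by rewrite in_itv /= ty.
  by move=> z; rewrite in_itv /= andbT; apply: nr.
by rewrite sg // -(sg u) // gtr0_sg.
Qed.

Lemma char_poly_gt0 (t : R) : (forall x, t <= x -> ~~ root (char_poly A) x) ->
  forall x, t <= x -> 0 < (char_poly A).[x].
Proof.
move=> nr x tx; rewrite -sgr_cp0 (sgp_pinftyP (x := t)).
- by rewrite /sgp_pinfty (monicP (char_poly_monic A)) sgr1.
- by move=> z; rewrite in_itv /= andbT; apply: nr.
- by rewrite in_itv /= tx.
Qed.

(** Descend from large arguments, where all components are positive, to the
    largest [m >= t] at which some component [j] vanishes.  There all components
    are nonnegative, so row [j] of [m y - A y = det (m - A)] has a nonpositive left
    side, while the determinant is positive. *)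
Lemma adjsum_gt0 (t : R) : (forall x, t <= x -> ~~ root (char_poly A) x) ->
  forall i, 0 < (adjsum i 0).[t].
Proof.
move=> nr; have det_gt0 := char_poly_gt0 nr.
pose u : R := `|t| + 1 + \sum_i \sum_j A i j.
have row_ge0 i : 0 <= \sum_j A i j by apply: sumr_ge0.
have sum_ge0 : 0 <= \sum_i \sum_j A i j by apply: sumr_ge0.
have t_norm := ler_norm t.
have tu : t < u by rewrite /u; lra.
have large (v : R) i : u <= v -> 0 < (adjsum i 0).[v].
  move=> uv; apply: adjsum_gt0_large => [|k];
    first exact/det_gt0/(le_trans (ltW tu)).
  apply: lt_le_trans uv; rewrite /u [X in _ + X](bigD1 k) //=.
  by rewrite addrCA ltrDl ltr_wpDr ?sumr_ge0 // ltr_wpDl.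
suff nrA i x : t <= x -> ~~ root (adjsum i 0) x.
  move=> i; apply: (noroot_gt0 (nrA i) (ltW tu) (large u i (lexx _))).
  exact: lexx.
move=> tx; apply/negP => rx.
(* The product turns the first zero of any component into a root of one
   polynomial. *)
pose q := \prod_j adjsum j 0.
have root_q y : root q y = [exists j, root (adjsum j 0) y].
  rewrite rootE horner_prod; apply/prodf_eq0/existsP => -[j].
    by move=> _ e; exists j.
  by move=> e; exists j.
have q0 : q != 0.
  apply/prodf_neq0 => j _; apply: contraTneq (large u j (lexx _)) => ->.
  by rewrite horner0 ltxx.
have [|m [qm tm max_m]] := @ex_largest_root q x t q0 _ tx.
  by rewrite root_q; apply/existsP; exists i.
have gt0_right j y : m < y -> 0 < (adjsum j 0).[y].
  move=> my; apply: (@noroot_gt0 _ y (Num.max u y));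
    rewrite ?le_max ?lexx ?orbT //.
    move=> z yz; apply/negP => rz.
    have : z <= m by apply: max_m; rewrite root_q; apply/existsP; exists j.
    lra.
  by apply: large; rewrite le_max lexx.
have ge0_m j : 0 <= (adjsum j 0).[m].
  by apply: horner_ge0_right => y /gt0_right/ltW.
move: qm; rewrite root_q => /existsP[j /eqP rj].
have := det_gt0 m tm; rewrite -(adjsumE m j) rj mulr0 sub0r oppr_gt0 ltNge.
by rewrite sumr_ge0 // => k _; rewrite mulr_ge0.
Qed.

(** Passing to the limit [t -> r] could give the zero vector.  If it does, all the
    polynomials are divisible by ['X - r]; dividing by this factor, positive on the
    right of [r], preserves the hypotheses and lowers the degree. *)
Lemma nonneg_subeigenvector_limit (r : R) (w : 'I_n -> {poly R}) (i0 : 'I_n) :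
  (forall i t, r < t -> 0 < (w i).[t]) ->
  (forall i t, r < t -> \sum_j A i j * (w j).[t] <= t * (w i).[t]) ->
  exists v : 'I_n -> R, [/\ forall i, 0 <= v i, exists i, v i != 0 &
    forall i, \sum_j A i j * v j <= r * v i].
Proof.
move Dk : (size (w i0)) => k; elim: k w Dk => [|k IH] w Dk w_gt0 w_sub.
  have := w_gt0 i0 (r + 1); move/eqP: Dk; rewrite size_poly_eq0 => /eqP->.
  by rewrite horner0 ltxx ltrDl ltr01 => /(_ isT).
have [/existsP[i wi0]|/existsPn wr0] := boolP [exists i, (w i).[r] != 0].
  exists (fun i => (w i).[r]); split; last 1 first.
  - move=> j; rewrite -subr_ge0.
    pose p := 'X * w j - \sum_l A j l *: w l.
    have pE t : p.[t] = t * (w j).[t] - \sum_l A j l * (w l).[t].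
      rewrite hornerD hornerN hornerM hornerX horner_sum; congr (_ - _).
      by apply: eq_bigr => l _; rewrite hornerZ.
    by rewrite -pE; apply: horner_ge0_right => t rt; rewrite pE subr_ge0 w_sub.
  - by move=> j; apply: horner_ge0_right => t /(w_gt0 j)/ltW.
  - by exists i.
have ex_w i : exists p, w i = p * ('X - r%:P).
  by apply/factor_theorem; rewrite rootE; move/negPn: (wr0 i).
pose w' i := w i %/ ('X - r%:P).
have w'E i : w i = w' i * ('X - r%:P).
  by have [p Dp] := ex_w i; rewrite /w' Dp mulpK // polyXsubC_eq0.
have w'h i t : (w i).[t] = (w' i).[t] * (t - r).
  by rewrite w'E hornerM hornerXsubC.
apply: (IH w').
- have : w' i0 != 0.
    apply: contraTneq isT => e; have := w_gt0 i0 (r + 1).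
    by rewrite w'h e horner0 mul0r ltxx ltrDl ltr01 => /(_ isT).
  move=> w'0; move: Dk.
  by rewrite w'E size_Mmonic ?monicXsubC // size_XsubC addn2 => -[].
- move=> i t rt; have := w_gt0 i t rt; rewrite w'h pmulr_lgt0 //; lra.
- move=> i t rt; have tr : 0 < t - r by lra.
  rewrite -(ler_pM2r tr) -mulrA -w'h mulr_suml.
  by under eq_bigr do rewrite -mulrA -w'h; apply: w_sub.
Qed.

End Perron.

Section SpectralRadius.
Import classical_sets.
Variables (R : realType) (n : nat) (A : 'M[R]_n).

Lemma root_le_spectral_radius t : 0 <= t -> root (char_poly A) t ->
  t <= spectral_radius A.
Proof.
move=> t0 rt; apply: ub_le_sup; last first.
  exists (t%:C)%C; last by rewrite ger0_norm // lecR.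
  by rewrite eigenvalue_root_char -map_char_poly fmorph_root.
(* The sum of the moduli of all eigenvalues bounds each of them. *)
have [s Ds] := closed_field_poly_normal
  (char_poly (map_mx (fun x : R => (x%:C)%C) A)).
exists (complex.Re (\sum_(z <- s) `|z|)) => r /= [l].
rewrite eigenvalue_root_char Ds (monicP (char_poly_monic _)) scale1r.
rewrite root_prod_XsubC => ls lr.
have : (r%:C)%C <= \sum_(z <- s) `|z|.
  by rewrite -lr (big_rem l) //= lerDl sumr_ge0.
by case: (\sum_(z <- s) _) => a b; rewrite lecE /= => /andP[].
Qed.

Hypothesis A_ge0 : forall i j, 0 <= A i j.

Lemma char_poly_noroot r : 0 <= r -> spectral_radius A < r ->
  forall x, r <= x -> ~~ root (char_poly A) x.
Proof.
move=> r0 Ar x rx; apply/negP => rootx.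
have := root_le_spectral_radius (le_trans r0 rx) rootx; lra.
Qed.

Lemma pos_strict_subeigenvector r : 0 <= r -> spectral_radius A < r ->
  exists2 v : 'I_n -> R, forall i, 0 < v i &
    forall i, \sum_j A i j * v j < r * v i.
Proof.
move=> r0 Ar; have nr := char_poly_noroot r0 Ar.
exists (fun i => (adjsum A i 0).[r]) => i; first exact: adjsum_gt0.
by rewrite -subr_gt0 adjsumE; apply: char_poly_gt0 nr _ (lexx _).
Qed.

Lemma nonneg_subeigenvector r : 0 <= r -> spectral_radius A <= r -> (0 < n)%N ->
  exists v : 'I_n -> R, [/\ forall i, 0 <= v i, exists i, v i != 0 &
    forall i, \sum_j A i j * v j <= r * v i].
Proof.
move=> r0 Ar n0.
have nr t : r < t -> forall x, t <= x -> ~~ root (char_poly A) x.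
  by move=> rt; apply: char_poly_noroot; lra.
apply: (@nonneg_subeigenvector_limit _ _ A r
         (fun i => adjsum A i 0) (Ordinal n0)).
  by move=> i t /nr nrt; apply: adjsum_gt0.
move=> i t /nr nrt; rewrite -subr_ge0 adjsumE ltW //.
exact: char_poly_gt0 nrt _ (lexx _).
Qed.
End SpectralRadius.

(** Listing the complement of [T] before [T] would make [A] block triangular. *)
Lemma irreducible_closed (R : realType) n (A : 'M[R]_n) (T : {set 'I_n}) :
  irreducible_mx A -> (forall i j, i \in T -> j \notin T -> A i j = 0) ->
  T != set0 -> T = setT.
Proof.
move=> irr closedT T0; apply/eqP; apply: contraT => TT; case: irr.
pose l := enum (~: T) ++ enum T.
have size_l : size l = n by rewrite size_cat -!cardE addnC cardsC card_ord.
have l_uniq : uniq l.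
  rewrite cat_uniq !enum_uniq andbT /=; apply/hasPn => x.
  by rewrite !mem_enum inE negbK.
pose f (i : 'I_n) := nth i l i.
have f_inj : injective f.
  move=> i j; rewrite /f (set_nth_default i j) ?size_l // => /eqP.
  by rewrite nth_uniq ?size_l // => /eqP/val_inj.
exists (perm f_inj), #|~: T|; split.
  rewrite card_gt0 -[X in (_ < X)%N]card_ord -(cardsC T) -[ltnLHS]add0n.
  rewrite ltn_add2r card_gt0 T0 andbT; apply: contra TT => /eqP e.
  by rewrite -(setCK T) e setC0.
move=> i j /andP[jk ki].
rewrite tr_perm_mx -row_permE -col_permE !mxE !permE.
apply: closedT.
  rewrite /f nth_cat -cardE ltnNge ki /= -mem_enum mem_nth // -cardE.
  by rewrite ltn_subLR // addnC cardsC card_ord.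
by rewrite -in_setC /f nth_cat -cardE jk -mem_enum mem_nth // -cardE.
Qed.

(** * Rescaling by a positive vector *)

Section Scaling.
Variables (R : realType) (s : nat) (S : 'M[R]_s).

Definition scaled (v : 'I_s -> R) i j : R := S i j * v j / v i.

Lemma abs_row_sum_scaled (v : 'I_s -> R) i : (forall j, 0 < v j) ->
  abs_row_sum setT (scaled v) i = (\sum_j absmx S i j * v j) / v i.
Proof.
move=> v_gt0; rewrite /abs_row_sum mulr_suml; apply: eq_big => [j|j _].
  by rewrite inE.
by rewrite !mxE !normrM normfV !(gtr0_norm (v_gt0 _)).
Qed.

(** In a row where [v] vanishes, [A v <= r v] forces [A] to vanish towards every
    index where [v] does not: the zero set of [v] is closed. *)
Lemma pos_subeigenvector_irreducible r : 0 <= r ->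
  spectral_radius (absmx S) <= r -> irreducible_mx S ->
  exists2 v : 'I_s -> R, forall i, 0 < v i &
    forall i, \sum_j absmx S i j * v j <= r * v i.
Proof.
move=> r0 Sr irr.
have [s0|s_gt0] := posnP s.
  by exists (fun=> 1) => i; have := ltn_ord i; rewrite [X in (_ < X)%N]s0.
have A_ge0 i j : 0 <= absmx S i j by rewrite mxE.
have [v [v_ge0 [i0 vi0] v_sub]] := nonneg_subeigenvector A_ge0 r0 Sr s_gt0.
exists v => // i; rewrite lt_def v_ge0 andbT; apply: contraNneq vi0 => vi.
pose T := [set j | v j == 0].
suff -> : v i0 = 0 by [].
suff /setP/(_ i0) : T = setT by rewrite !inE => /eqP.
apply: (irreducible_closed irr); last by apply/set0Pn; exists i; rewrite inE vi.
move=> j k; rewrite !inE => /eqP vj vk.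
have := v_sub j; rewrite vj mulr0 (bigD1 k) //= => sum_le0.
have : absmx S j k * v k <= 0.
  apply: le_trans sum_le0; rewrite lerDl sumr_ge0 // => l _.
  by rewrite mulr_ge0.
by rewrite mxE pmulr_lle0 ?normr_le0 ?lt_def ?vk ?v_ge0 // => /eqP.
Qed.

Lemma scaled_half_dominant :
  spectral_radius (absmx S) < 2^-1 \/
    (spectral_radius (absmx S) = 2^-1 /\ irreducible_mx S) ->
  exists2 v : 'I_s -> R, forall i, 0 < v i & half_dominant setT (scaled v).
Proof.
have half_ge0 : 0 <= 2^-1 :> R by lra.
case=> [lt_half|[eq_half irr]].
  have A_ge0 i j : 0 <= absmx S i j by rewrite mxE.
  have [v v_gt0 v_sub] := pos_strict_subeigenvector A_ge0 half_ge0 lt_half.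
  have strict i : abs_row_sum setT (scaled v) i < 2^-1.
    by rewrite abs_row_sum_scaled // ltr_pdivrMr.
  exists v => //; split=> [i _|T /set0Pn[i Ti] _ _]; first exact: ltW.
  by right; exists i.
have le_half : spectral_radius (absmx S) <= 2^-1 by rewrite eq_half.
have [v v_gt0 v_sub] := pos_subeigenvector_irreducible half_ge0 le_half irr.
exists v => //; split=> [i _|T T0 _ closedT].
  by rewrite abs_row_sum_scaled // ler_pdivrMr.
left; apply: (irreducible_closed irr) => // i j Ti nTj.
have : j \in setT :\: T by rewrite !inE nTj.
move=> /(closedT i j Ti)/eqP.
by rewrite /scaled !mulf_eq0 invr_eq0 !(gt_eqF (v_gt0 _)) !orbF => /eqP.
Qed.

Lemma Sigma_mxE (sigma x : 'cV[R]_s) i :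
  (Sigma_mx sigma *m x) i 0 = sigma i 0 * x i 0.
Proof. by rewrite mul_diag_mx !mxE. Qed.

Lemma solves_scaled (v : 'I_s -> R) (sigma x c : 'cV[R]_s) :
  (forall i, 0 < v i) ->
  (1%:M - S *m Sigma_mx sigma) *m x = c ->
  solves setT (scaled v) (fun i => c i 0 / v i) (sigma ^~ 0)
    (fun i => x i 0 / v i).
Proof.
move=> v_gt0 <- i _; have v0 j : v j != 0 by rewrite gt_eqF.
rewrite mulmxBl mul1mx -mulmxA.
have -> : \sum_(j in setT) scaled v i j * (sigma j 0 * (x j 0 / v j)) =
          (S *m (Sigma_mx sigma *m x)) i 0 / v i.
  rewrite mxE mulr_suml; apply: eq_big => [j|j _]; first by rewrite inE.
  by rewrite Sigma_mxE /scaled; field; rewrite !v0.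
by rewrite !mxE -mulrDl subrK.
Qed.

Lemma sigma_box_in_box (sigma : 'cV[R]_s) :
  sigma_box sigma -> in_box setT (sigma ^~ 0).
Proof. by move=> box i _; rewrite ler_norml box. Qed.

Lemma unitmx_of_half_dominant (v : 'I_s -> R) (sigma : 'cV[R]_s) :
  (forall i, 0 < v i) -> half_dominant setT (scaled v) -> sigma_box sigma ->
  1%:M - S *m Sigma_mx sigma \in unitmx.
Proof.
move=> v_gt0 dom box; set M := _ - _.
rewrite -unitmx_tr -row_free_unit -kermx_eq0; apply/rowV0P => y /sub_kermxP yM.
have {yM} : M *m y^T = 0 by rewrite -[M]trmxK -trmx_mul yM trmx0.
move/(solves_scaled v_gt0) => sol; apply/rowP => i; rewrite mxE.
have : y^T i 0 / v i = 0.
  apply: solves0 dom (sigma_box_in_box box) sol _ _ => [j _|];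
    by rewrite ?mxE ?mul0r ?inE.
by move=> /eqP; rewrite mxE mulf_eq0 invr_eq0 (gt_eqF (v_gt0 i)) orbF => /eqP.
Qed.

Lemma signature_iteration_scaled (v : 'I_s -> R) (c : 'cV[R]_s)
    (z sigma : nat -> 'cV[R]_s) :
  (forall i, 0 < v i) -> half_dominant setT (scaled v) ->
  signature_iteration S c z sigma ->
  sign_iteration setT (scaled v) (fun i => c i 0 / v i)
    (fun k i => z k i 0 / v i) (fun k i => sigma k i 0).
Proof.
move=> v_gt0 dom iter k; have [box compat step] := iter k; split.
- exact: sigma_box_in_box.
- move=> i _; rewrite mulrA -Sigma_mxE -compat mxE normrM normfV.
  by rewrite (gtr0_norm (v_gt0 i)).
- apply: solves_scaled => //; rewrite step mulKVmx //.
  exact: unitmx_of_half_dominant dom box.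
Qed.

End Scaling.

(** * Finite convergence *)

(** The modulus is 1-Lipschitz, so its difference quotients form a signature; this
    turns a difference of values of [Hmap] into a linear map. *)
Lemma ex_signature (R : realType) s (x y : 'cV[R]_s) :
  exists2 sigma, sigma_box sigma & absmx x - absmx y = Sigma_mx sigma *m (x - y).
Proof.
pose q i : R := (`|x i 0| - `|y i 0|) / (x i 0 - y i 0).
exists (\col_i q i).
  move=> i; rewrite mxE -ler_norml /q normrM normfV.
  have [->|d0] := eqVneq (x i 0 - y i 0) 0; first by rewrite normr0 invr0 mulr0.
  by rewrite ler_pdivrMr ?normr_gt0 // mul1r ler_dist_dist.
apply/colP => i; rewrite Sigma_mxE !mxE /q.
have [/eqP|d0] := eqVneq (x i 0 - y i 0) 0; last by rewrite divfK.
by rewrite subr_eq0 => /eqP ->; rewrite !subrr mulr0.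
Qed.

(** At zero components of [x] the entries of [sigma] are free, and harmless since
    [y] vanishes there as well. *)
Lemma absmx_sgr (R : realType) s (x y : 'cV[R]_s) sigma :
  (forall i, Num.sg (x i 0) = Num.sg (y i 0)) -> absmx x = Sigma_mx sigma *m x ->
  absmx y = Sigma_mx sigma *m y.
Proof.
move=> sg_xy /colP compat; apply/colP => i; rewrite Sigma_mxE mxE.
have [y0|y0] := eqVneq (y i 0) 0; first by rewrite y0 normr0 mulr0.
have x0 : x i 0 != 0 by rewrite -sgr_eq0 sg_xy sgr_eq0.
have := compat i; rewrite Sigma_mxE mxE => /esym/(sigma_sgr x0) ->.
by rewrite sg_xy normrEsg.
Qed.

Lemma Hmap_Sigma (R : realType) s (S : 'M[R]_s) (x sigma : 'cV[R]_s) :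
  absmx x = Sigma_mx sigma *m x -> Hmap S x = (1%:M - S *m Sigma_mx sigma) *m x.
Proof. by rewrite /Hmap => ->; rewrite mulmxBl mul1mx mulmxA. Qed.

Definition sgr_cv (R : realType) s (x : 'cV[R]_s) : 'cV[R]_s := map_mx Num.sg x.

Lemma sgr_cv_box (R : realType) s (x : 'cV[R]_s) : sigma_box (sgr_cv x).
Proof. by move=> i; rewrite mxE -ler_norml normr_sg lern1 leq_b1. Qed.

Lemma absmx_sgr_cv (R : realType) s (x : 'cV[R]_s) :
  absmx x = Sigma_mx (sgr_cv x) *m x.
Proof. by apply/colP => i; rewrite Sigma_mxE !mxE normrEsg. Qed.

Theorem proposition7p5 (R : realType) (n s : nat) (A : abs_normal_form R n s)
    (hJ : anf_J A \in unitmx)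
    (hrho : spectral_radius (absmx (schur_complement A)) < 2^-1 \/
            (spectral_radius (absmx (schur_complement A)) = 2^-1 /\
             irreducible_mx (schur_complement A))) :
  let S := schur_complement A in
  forall chat : 'cV[R]_s,
    (forall sigma : 'cV[R]_s, sigma_box sigma ->
       1%:M - S *m Sigma_mx sigma \in unitmx) /\
    exists zstar : 'cV[R]_s,
      [/\ Hmap S zstar = chat,
          forall z : 'cV[R]_s, Hmap S z = chat -> z = zstar
        & forall z sigma : nat -> 'cV[R]_s,
            signature_iteration S chat z sigma ->
            converges_within s z zstar].
Proof.
move=> S chat; have [v v_gt0 dom] := scaled_half_dominant hrho.
have unit sigma : sigma_box sigma -> 1%:M - S *m Sigma_mx sigma \in unitmx.
  exact: unitmx_of_half_dominant.
split=> //.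
have [tau tauP] := sign_iteration_stabilizes (fun i => chat i 0 / v i) dom.
have sg_scaled (x : 'cV[R]_s) i : Num.sg (x i 0 / v i) = Num.sg (x i 0).
  by rewrite sgrM sgrV (gtr0_sg (v_gt0 i)) mulr1.
have {}tauP z sigma : signature_iteration S chat z sigma ->
    forall k i, (s <= k)%N -> Num.sg (z k i 0) = tau i.
  move=> /(signature_iteration_scaled v_gt0 dom)/tauP H k i sk.
  by rewrite -sg_scaled H ?inE // cardsT card_ord.
have step sigma x : sigma_box sigma ->
    x = invmx (1%:M - S *m Sigma_mx sigma) *m chat <->
    (1%:M - S *m Sigma_mx sigma) *m x = chat.
  by move=> box; split=> [->|<-]; rewrite ?mulKmx ?mulKVmx ?unit.
have inj x y : Hmap S x = Hmap S y -> x = y.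
  have [sigma box Dsigma] := ex_signature x y.
  have e : (1%:M - S *m Sigma_mx sigma) *m (x - y) = Hmap S x - Hmap S y.
    rewrite mulmxBl mul1mx -mulmxA -Dsigma mulmxBr /Hmap !opprB -!addrA.
    by congr (_ + _); rewrite addrCA [RHS]addrCA [- y - _]addrC.
  move=> /eqP; rewrite -subr_eq0 -e => /eqP.
  move/(congr1 (mulmx (invmx (1%:M - S *m Sigma_mx sigma)))).
  by rewrite mulKmx ?unit // mulmx0 => /eqP; rewrite subr_eq0 => /eqP.
(* The solution is step [s + 1] of the iteration with signatures [sg z], begun
   anywhere: its signature no longer changes after step [s]. *)
pose next x := invmx (1%:M - S *m Sigma_mx (sgr_cv x)) *m chat.
pose zs k := iter k next 0.
have zsP : signature_iteration S chat zs (fun k => sgr_cv (zs k)).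
  by move=> k; split; [exact: sgr_cv_box|exact: absmx_sgr_cv|].
pose zstar := zs s.+1.
have zstarP : Hmap S zstar = chat.
  rewrite (@Hmap_Sigma _ _ _ _ (sgr_cv (zs s)));
    first exact/step/erefl/sgr_cv_box.
  apply: absmx_sgr (absmx_sgr_cv (zs s)) => i.
  by rewrite !(tauP _ _ zsP).
exists zstar; split=> // [z Hz|z sigma zP]; first by apply: inj; rewrite Hz.
have sg_star k i : (s <= k)%N -> Num.sg (z k i 0) = Num.sg (zstar i 0).
  by move=> sk; rewrite (tauP _ _ zP) // (tauP _ _ zsP).
exists s; split=> // [i|[//|k]]; first exact: sg_star.
rewrite ltnS => sk; have [box compat ->] := zP k; apply/esym/step => //.
rewrite -Hmap_Sigma //; apply: absmx_sgr compat => i; exact: sg_star.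
Qed.
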